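(* Let $n \geq 1$, $r \geq 2$ and $k \geq 1$ be integers. Then \[ \mathrm{ex}(n,P_k^r) \leq \begin{cases} \frac{k-1}{2}\binom{n}{r-1} & \text{if } r \text{ is even},\\[2pt] \frac{1}{2}\left(k + \left\lfloor \frac{k-1}{r}\right\rfloor\right)\binom{n}{r-1} & \text{if } r \text{ is odd}. \end{cases}\]
   Context: An $r$-graph is an $r$-uniform hypergraph. For $k \geq 1$ and $r \geq 2$, a tight $k$-path $P_k^r$ is the $r$-graph on distinct vertices $v_0, v_1, \dots, v_{k+r-2}$ with edge set $\{\{v_i, v_{i+1}, \dots, v_{i+r-1}\} : 0 \leq i < k\}$. $\mathrm{ex}(n,P_k^r)$ denotes the maximum number of edges in an $n$-vertex $r$-graph that contains no tight $k$-path (as a subhypergraph). *)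

(* Defs.v *)
From mathcomp Require Import all_boot all_order all_algebra.

Set Implicit Arguments.
Unset Strict Implicit.
Unset Printing Implicit Defensive.

Definition uniform (V : finType) (r : nat) (H : {set {set V}}) : bool :=
  [forall e in H, #|e| == r].

(* Not necessarily induced copies: only edges of F have to be mapped to edges. *)
Definition contains_copy (U V : finType) (F : {set {set U}})
    (H : {set {set V}}) : bool :=
  [exists f : {ffun U -> V}, injectiveb f && [forall e in F, f @: e \in H]].

Definition turan_ex (n r : nat) (U : finType) (F : {set {set U}}) : nat :=
  \max_(H : {set {set 'I_n}} | uniform r H && ~~ contains_copy F H) #|H|.

(* The vertex v_j is represented by j : 'I_(k + r - 1). *)
Definition tight_path (k r : nat) : {set {set 'I_(k + r - 1)}} :=
  [set [set j : 'I_(k + r - 1) | i <= j < i + r] | i : 'I_k].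

(* Main.v *)
Require Import Defs.
From mathcomp Require Import all_boot all_order all_algebra.
From mathcomp Require Import zify ring.

Set Implicit Arguments.
Unset Strict Implicit.
Unset Printing Implicit Defensive.

(** Give the [r] slots of a tight path (vertex [v_q] sits in slot [q mod r])
    the colours [s./2], so that slots [2j] and [2j+1] share a colour (and the
    last slot is alone when [r] is odd).  Fix a colouring [c] of the vertices
    and consider the orderings [x] of edges of [H] whose slots carry the right
    colours.  The two vertices of a shared colour bound an arc of the cyclic
    order on the vertices, and replacing one of them by a vertex inside the arc
    shrinks it, so no vertex is ever reused; a lone slot only moves upwards.
    If we follow all orderings simultaneously, changing slot [t mod r] at time
    [t], then at most one ordering is lost for each way of fixing the other
    [r - 1] slots, because any two admissible vertices for the moving slot are
    comparable.  If there is no tight [k]-path, everything is lost after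
    [k - 1] steps.  Averaging over all colourings [c : V -> 'I_r], where slot
    [s] accepts [w s] of the [r] values ([w s = 2], or [1] for a lone slot),
    gives [|H| <= 'C(n, r - 1) * \sum_(t < k - 1) 1 / w (t mod r)]. *)

(* [v] lies strictly inside the cyclic arc that goes upwards from [a] to [b]. *)
Definition between (a v b : nat) : bool :=
  [|| a < v < b, v < b < a | b < a < v].

(** * Orderings, free regions and the tight paths they trace *)

Section States.
Variables (n m : nat) (H : {set {set 'I_n}}).
Implicit Types (x y : {ffun 'I_m.+1 -> 'I_n}) (c : {ffun 'I_n -> 'I_m.+1}).

(* [j] is a colour; the vertices that slots of colour [j] may still visit. *)
Definition free_region x (j : nat) (v : 'I_n) : bool :=
  if j.*2.+1 < m.+1 then between (x (inord j.*2)) v (x (inord j.*2.+1))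
  else x (inord j.*2) < v.

Lemma free_region_self x (s : 'I_m.+1) : ~~ free_region x s./2 (x s).
Proof.
have ls := ltn_ord s; have := odd_double_half s.
rewrite /free_region /between; case: ifP => h.
  case: (odd s) => /= e.
    have -> : inord (s./2).*2.+1 = s by apply: val_inj; rewrite /= inordK; lia.
    by lia.
  have -> : inord (s./2).*2 = s by apply: val_inj; rewrite /= inordK; lia.
  by lia.
case: (odd s) => /= e; first by lia.
have -> : inord (s./2).*2 = s by apply: val_inj; rewrite /= inordK; lia.
by lia.
Qed.

Lemma free_region_other x y (s : 'I_m.+1) j v :
  (forall i, i != s -> x i = y i) -> j.*2 < m.+1 -> j != s./2 ->
  free_region y j v = free_region x j v.
Proof.
move=> xy jm js; rewrite /free_region.
have ls := ltn_ord s; have := odd_double_half s => e.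
rewrite xy; last by rewrite -val_eqE /= inordK //; lia.
by case: ifP => // h; rewrite xy // -val_eqE /= inordK //; lia.
Qed.

(** Moving one end of a cyclic arc to a point inside it leaves a subarc; for a lone slot this is
    transitivity of the order. *)
Lemma free_region_shrink x y (s : 'I_m.+1) v :
  (forall i, i != s -> x i = y i) -> free_region x s./2 (y s) ->
  free_region y s./2 v -> free_region x s./2 v.
Proof.
move=> xy; rewrite /free_region /between.
have ls := ltn_ord s; have := odd_double_half s => e.
case: ifP => h.
  move: e; case: (odd s) => /= e.
    have -> : inord (s./2).*2.+1 = s by apply: val_inj; rewrite /= inordK; lia.
    rewrite xy; first by lia.
    by rewrite -val_eqE /= inordK; lia.
  have -> : inord (s./2).*2 = s by apply: val_inj; rewrite /= inordK; lia.
  rewrite [x (inord _)]xy; first by lia.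
  by rewrite -val_eqE /= inordK; lia.
move: e; case: (odd s) => /= e; first by lia.
have -> : inord (s./2).*2 = s by apply: val_inj; rewrite /= inordK; lia.
by lia.
Qed.

(** For a shared colour, [x s], [y s] and the common vertex of the partner slot are three distinct
    points of the cyclic order. Of the two arcs that they bound at the partner, one contains the
    moving end of the other. For a lone slot the order is total. *)
Lemma free_region_total x y (s : 'I_m.+1) :
  injective x -> injective y -> (forall i, i != s -> x i = y i) -> x != y ->
  free_region x s./2 (y s) || free_region y s./2 (x s).
Proof.
move=> ix iy xy nxy.
have ns : x s != y s :> nat.
  apply: contra nxy => /eqP es; apply/eqP/ffunP => i.
  by have [->|/xy//] := eqVneq i s; apply: val_inj.
rewrite /free_region /between.
have ls := ltn_ord s; have := odd_double_half s => e.
have inje (z : {ffun 'I_m.+1 -> 'I_n}) i :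
    injective z -> i != s -> z i != z s :> nat.
  by move=> iz; apply: contra => /eqP/ord_inj/iz ->.
case: ifP => h.
  move: e; case: (odd s) => /= e.
    have -> : inord (s./2).*2.+1 = s by apply: val_inj; rewrite /= inordK; lia.
    have ne : (inord (s./2).*2 : 'I_m.+1) != s.
      by rewrite -val_eqE /= inordK; lia.
    by have := inje _ _ ix ne; have := inje _ _ iy ne; rewrite xy //; lia.
  have -> : inord (s./2).*2 = s by apply: val_inj; rewrite /= inordK; lia.
  have ne : (inord (s./2).*2.+1 : 'I_m.+1) != s.
    by rewrite -val_eqE /= inordK; lia.
  by have := inje _ _ ix ne; have := inje _ _ iy ne; rewrite xy //; lia.
move: e; case: (odd s) => /= e; first by lia.
have -> : inord (s./2).*2 = s by apply: val_inj; rewrite /= inordK; lia.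
by lia.
Qed.

(** Colours are compared as halves of values in ['I_m.+1], so that a uniformly chosen [c] gives a
    shared colour twice the weight of a lone one. *)
Definition states c : {set {ffun 'I_m.+1 -> 'I_n}} :=
  [set x : {ffun 'I_m.+1 -> 'I_n} | [&& injectiveb x, x @: setT \in H
             & [forall s, (c (x s))./2 == s./2]]].

Definition slot (t : nat) : 'I_m.+1 := inord (t %% m.+1).

Lemma slotE t : slot t = t %% m.+1 :> nat.
Proof. by rewrite /slot inordK // ltn_mod. Qed.

(* Orderings of the last edge of a tight path with [t.+1] edges. *)
Fixpoint path_ends c (t : nat) : {set {ffun 'I_m.+1 -> 'I_n}} :=
  if t isn't t'.+1 then states c else
  [set y : {ffun 'I_m.+1 -> 'I_n} in states c |
   [exists x : {ffun 'I_m.+1 -> 'I_n} in path_ends c t',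
     [forall i, (i != slot t') ==> (x i == y i)]
     && free_region x (slot t')./2 (y (slot t'))]].

Lemma path_ends_states c t x : x \in path_ends c t -> x \in states c.
Proof. by case: t => [|t] //=; rewrite inE => /andP[]. Qed.

Definition partial_states c (s : 'I_m.+1) : {set {ffun 'I_m -> 'I_n}} :=
  [set y : {ffun 'I_m -> 'I_n} | injectiveb y &&
   [forall i, (c (y i))./2 == (lift s i)./2]].

(* An ordering lost at time [t] is determined by its slots other than [slot t]:
   of two that agree there, one would have been reached from the other. *)
Lemma path_ends_step c t :
  #|path_ends c t| <= #|path_ends c t.+1| + #|partial_states c (slot t)|.
Proof.
set s := slot t.
rewrite -(cardsID (path_ends c t.+1) (path_ends c t)) leq_add //.
  by rewrite subset_leq_card // subsetIr.
pose er (x : {ffun 'I_m.+1 -> 'I_n}) := [ffun i : 'I_m => x (lift s i)].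
have eri : {in path_ends c t :\: path_ends c t.+1 &, injective er}.
  move=> x y /setDP[xt xT] /setDP[yt yT] exy.
  have agree i : i != s -> x i = y i.
    case: (unliftP s i) => [j ->|->]; last by rewrite eqxx.
    by move=> _; have /ffunP/(_ j) := exy; rewrite !ffunE.
  apply/eqP; apply: contraT => nxy.
  have xS := path_ends_states xt; have yS := path_ends_states yt.
  have ix : injective x by move: xS; rewrite inE => /and3P[/injectiveP].
  have iy : injective y by move: yS; rewrite inE => /and3P[/injectiveP].
  case/orP: (free_region_total ix iy agree nxy) => h.
    case/negP: yT => /=; rewrite inE yS; apply/existsP; exists x.
    rewrite xt h andbT; apply/forallP => i; apply/implyP => /agree ->; exact: eqxx.
  case/negP: xT => /=; rewrite inE xS; apply/existsP; exists y.
  rewrite yt h andbT; apply/forallP => i; apply/implyP => /agree ->; exact: eqxx.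
rewrite -(card_in_imset eri) subset_leq_card //.
apply/subsetP => _ /imsetP[x /setDP[/path_ends_states xS _] ->].
move: xS; rewrite !inE => /and3P[/injectiveP ix _ /forallP cx].
apply/andP; split.
  by apply/injectiveP => i j; rewrite !ffunE => /ix /lift_inj.
by apply/forallP => i; rewrite ffunE.
Qed.

(** Each step appends the new vertex of the moving slot. The last three clauses are the invariant:
    visited vertices carry the colour of their slot, the latest [m.+1] of them form [x], and none
    lies in the current free region of its colour. A vertex taken from that region is therefore
    new. *)
Lemma path_ends_path c t x : x \in path_ends c t ->
  exists p : nat -> 'I_n,
  [/\ forall q q', q < t + m.+1 -> q' < t + m.+1 -> p q = p q' -> q = q',
      forall i, i <= t -> [set p (i + j) | j : 'I_m.+1] \in H,
      forall q, q < t + m.+1 -> (c (p q))./2 = (slot q)./2,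
      forall q, t <= q < t + m.+1 -> x (slot q) = p q
    & forall q, q < t + m.+1 -> ~~ free_region x (slot q)./2 (p q)].
Proof.
elim: t x => [|t IHt] x.
  rewrite /= inE => /and3P[/injectiveP ix xH /forallP cx].
  exists (fun q => x (slot q)).
  split=> // [q q' lq lq' /ix /(congr1 val) /=|i|q _|q _].
  - by rewrite !slotE !modn_small.
  - rewrite leqn0 => /eqP ->.
    have -> // : [set x (slot (0 + j)) | j : 'I_m.+1] = x @: setT.
    apply/setP => v; apply/imsetP/imsetP => [][j _ ->].
      by exists (slot j).
    exists j => //; congr (x _); apply: val_inj.
    by rewrite /= slotE modn_small // add0n.
  - exact/eqP.
  - exact: free_region_self.
rewrite /= inE => /andP[xS /existsP[y /andP[/IHt[p [pinj pH pc py pf]]]]].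
set s := slot t => /andP[/forallP agree h].
have yx i : i != s -> y i = x i by move/(implyP (agree i))/eqP.
move: xS; rewrite inE => /and3P[/injectiveP ix xH /forallP cx].
have st : slot (t + m.+1) = s.
  by apply: val_inj; rewrite /= !slotE modnDr.
(* A visited vertex equal to [x s] would have the colour of [s], hence lie outside the region of [y]
   that contains [x s]. *)
have new q : q < t + m.+1 -> p q != x s.
  move=> lq; apply: contra (pf q lq) => /eqP e.
  by rewrite -(pc q lq) e (eqP (cx s)).
exists (fun q => if q == t + m.+1 then x s else p q).
split.
- move=> q q'; rewrite addSn !ltnS => lq lq'.
  case: eqP => [->|/eqP nq]; case: eqP => [->|/eqP nq'] // e.
  + by case/eqP: (new q' ltac:(lia)).
  + by case/eqP: (new q ltac:(lia)).
  + by apply: pinj e; lia.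
- move=> i; rewrite leq_eqVlt => /orP[/eqP ->|li].
    suff <- : x @: setT =
        [set (if t.+1 + j == t + m.+1 then x s else p (t.+1 + j))
          | j : 'I_m.+1] by [].
    apply/setP => v; apply/imsetP/imsetP => [][j _ ->].
      have [js|js] := eqVneq j s.
        by exists ord_max => //=; rewrite addSnnS eqxx js.
      (* The position congruent to [j] lies in the same block of length [m.+1] as [t] if [j] exceeds
         the residue of [t], and in the next block otherwise. *)
      have [q /andP[tq qt] qj] : exists2 q, t < q < t + m.+1 & slot q = j.
        have ej := divn_eq t m.+1; have := ltn_ord j => lj.
        have es : val s = t %% m.+1 by rewrite -slotE.
        have nej : j != t %% m.+1 :> nat by rewrite -es.
        exists (if t %% m.+1 < j then (t %/ m.+1 * m.+1) + j
                else (t %/ m.+1).+1 * m.+1 + j).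
          move: ej nej; rewrite mulSn.
          set a := _ * _; set b := t %% _ => ej nej.
          have lb : b < m.+1 by rewrite ltn_mod.
          by case: ifP; lia.
        by apply: val_inj; rewrite /= slotE; case: ifP => _;
           rewrite modnMDl modn_small.
      have lq : q - t.+1 < m.+1 by lia.
      exists (Ordinal lq) => //=; rewrite subnKC //.
      rewrite -py ?(ltnW tq) // qj yx //.
      by rewrite ifN //; lia.
    have lj := ltn_ord j.
    case: ifP => [_|/negbT nj]; first by exists s.
    exists (slot (t.+1 + j)) => //.
    rewrite -py; last by lia.
    rewrite yx // -val_eqE /= !slotE; apply/negP.
    rewrite -[X in _ == X %% _]addn0 addSnnS eqn_modDl mod0n.
    by rewrite modn_small; lia.
  rewrite (@eq_imset _ _ _ (fun j : 'I_m.+1 => p (i + j))) ?pH // => j.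
  have lj := ltn_ord j; rewrite ifN //; lia.
- move=> q lq; case: eqP => [->|nq]; first by rewrite st (eqP (cx s)).
  by rewrite pc //; lia.
- move=> q lq; case: eqP => [->|nq]; first by rewrite st.
  rewrite -py; last by lia.
  rewrite yx // -val_eqE /= !slotE; apply/negP.
  have -> : q = t + (q - t) by lia.
  rewrite -[X in _ == X %% _]addn0 eqn_modDl mod0n.
  by rewrite modn_small; lia.
- move=> q lq; case: eqP => [->|nq]; first by rewrite st free_region_self.
  have lq' : q < t + m.+1 by lia.
  (* The region of the moving colour has shrunk; those of other colours are unchanged. *)
  have [e|ne] := eqVneq (slot q)./2 s./2.
    rewrite e; apply: contra (pf q lq'); rewrite e.
    exact: free_region_shrink.
  rewrite (free_region_other _ yx) ?pf //.
  by have := ltn_ord (slot q); lia.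
Qed.

Lemma path_ends_contains_copy c t x :
  x \in path_ends c t -> contains_copy (tight_path t.+1 m.+1) H.
Proof.
case/path_ends_path => p [pinj pH _ _ _].
have sz : t.+1 + m.+1 - 1 = t + m.+1 by lia.
apply/existsP; exists [ffun j : 'I_(t.+1 + m.+1 - 1) => p j]; apply/andP; split.
  apply/injectiveP => i j; rewrite !ffunE => e; apply: val_inj.
  by apply: pinj e; rewrite -sz.
apply/forallP => e; apply/implyP => /imsetP[i _ ->].
suff -> : [ffun j : 'I_(t.+1 + m.+1 - 1) => p j] @:
      [set j : 'I_(t.+1 + m.+1 - 1) | i <= j < i + m.+1]
    = [set p (i + j) | j : 'I_m.+1] by apply: pH; rewrite -ltnS.
apply/esym/setP => v; apply/imsetP/imsetP => [][j].
  move=> _ ->; have li := ltn_ord i; have lj := ltn_ord j.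
  have l : i + j < t.+1 + m.+1 - 1 by lia.
  by exists (Ordinal l); rewrite ?ffunE ?inE //=; lia.
rewrite inE => /andP[ij ji] ->.
have l : j - i < m.+1 by lia.
by exists (Ordinal l); rewrite ?ffunE //= subnKC.
Qed.

Lemma card_states_le c k : ~~ contains_copy (tight_path k.+1 m.+1) H ->
  #|states c| <= \sum_(t < k) #|partial_states c (slot t)|.
Proof.
move=> nH.
have step t : #|states c| <=
    #|path_ends c t| + \sum_(i < t) #|partial_states c (slot i)|.
  elim: t => [|t IHt]; first by rewrite big_ord0 addn0.
  rewrite big_ord_recr /=; have := path_ends_step c t; move: IHt => /=; lia.
have := step k; suff -> : path_ends c k = set0 by rewrite cards0.
apply/setP => x; rewrite in_set0; apply: contraNF nH.
exact: path_ends_contains_copy.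
Qed.

End States.

(** * Counting colourings under constraints *)

Lemma card_ffun_constrained (n r m : nat) (y : 'I_m -> 'I_n)
    (P : 'I_m -> pred 'I_r) : injective y ->
  #|[set c : {ffun 'I_n -> 'I_r} | [forall i, P i (c (y i))]]|
  = (\prod_i #|P i|) * r ^ (n - m).
Proof.
move=> iy.
(* The constraints are regrouped by vertex: one at each [y i], as [y] is injective, and none off its
   image. *)
pose F v : pred 'I_r := [pred a | [forall i, (y i == v) ==> P i a]].
have -> : #|[set c : {ffun 'I_n -> 'I_r} | [forall i, P i (c (y i))]]| =
          #|(family F : {pred {ffun 'I_n -> 'I_r}})|.
  rewrite cardsE; apply: eq_card => c; apply/forallP/familyP => [h v|h i].
    by apply/forallP => i; apply/implyP => /eqP <-.
  by have /forallP/(_ i) := h (y i); rewrite eqxx.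
rewrite card_family foldrE big_image /= (bigID (mem (y @: setT))) /=.
congr (_ * _).
  rewrite big_imset /=; last by move=> ? ? _ _; apply: iy.
  apply: eq_big => [i|i _]; first by rewrite inE.
  apply: eq_card => a; apply/forallP/idP => [/(_ i)|h j].
    by rewrite eqxx.
  by apply/implyP => /eqP/iy ->.
rewrite (eq_bigr (fun=> r)); last first.
  move=> v nv; rewrite -[RHS]card_ord; apply: eq_card => a.
  rewrite !inE; apply/forallP => i; apply/implyP => /eqP e.
  by case/negP: nv; rewrite -e imset_f.
rewrite prod_nat_const; congr (_ ^ _).
have := cardsC (y @: setT); rewrite card_imset // cardsT !card_ord => e.
by rewrite -[X in _ = X - m]e addKn; apply: eq_card => v; rewrite !inE.
Qed.

Definition slot_weight (r : nat) (s : 'I_r) :=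
  #|[pred i : 'I_r | i./2 == s./2]|.

(** A colour class [{2j, 2j+1}] loses its upper element only at the last slot, when the uniformity
    [m.+1] is odd. *)
Lemma slot_weightE (m : nat) (s : 'I_m.+1) :
  slot_weight s = (~~ (~~ odd m && (s == m :> nat))).+1.
Proof.
have ls := ltn_ord s; have := odd_double_half s => e.
have := odd_double_half m => em.
rewrite /slot_weight; case: (boolP (_ && _)) => h /=.
  rewrite -(card1 s); apply: eq_card => i; rewrite !inE -val_eqE.
  have := ltn_ord i; have := odd_double_half i.
  by move: h e em; case: (odd m) => //=; lia.
pose a : 'I_m.+1 := inord (s./2).*2; pose b : 'I_m.+1 := inord (s./2).*2.+1.
have lb : (s./2).*2.+1 < m.+1
  by move: h e em; case: (odd m); case: (odd s) => /=; lia.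
have ea : val a = (s./2).*2 by rewrite /= inordK //; lia.
have eb : val b = (s./2).*2.+1 by rewrite /= inordK.
have <- : #|[set a; b]| = 2 by rewrite cards2 -val_eqE ea eb; lia.
apply: eq_card => i; rewrite !inE -!val_eqE ea eb.
by have := odd_double_half i; case: (odd i) => /=; lia.
Qed.

Lemma sum_exchange_card (I T : finType) (X : {set T}) (Q : I -> T -> bool) :
  \sum_c #|[set x in X | Q c x]| = \sum_(x in X) #|[set c | Q c x]|.
Proof.
under eq_bigr => c _ do rewrite -sum1dep_card big_mkcondr.
rewrite exchange_big; apply: eq_bigr => x _.
by rewrite -sum1dep_card -big_mkcond.
Qed.

(** * Averaging over all colourings *)

Section Averaging.
Variables (n m : nat) (H : {set {set 'I_n}}).
Hypothesis H_uniform : uniform m.+1 H.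

Lemma card_edge_orderings :
  #|[set x : {ffun 'I_m.+1 -> 'I_n} | injectiveb x & x @: setT \in H]|
  = #|H| * m.+1`!.
Proof.
rewrite -sum1dep_card
  (partition_big (fun x : {ffun 'I_m.+1 -> 'I_n} => x @: setT) (mem H)) /=;
  last first.
  by move=> x /andP[].
rewrite -sum_nat_const; apply: eq_bigr => e eH.
have ce : #|e| = m.+1 by apply/eqP; move/forallP/(_ e): H_uniform; rewrite eH.
have := card_inj_ffuns_on 'I_m.+1 (mem e); rewrite ce card_ord ffactnn => <-.
rewrite sum1dep_card; apply: eq_card => x; rewrite !inE.
apply/idP/idP => [/andP[/andP[-> _] /eqP <-]|/andP[/ffun_onP xe ix]].
  by rewrite andbT; apply/ffun_onP => i; rewrite imset_f.
have -> : x @: setT = e.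
  apply/eqP; rewrite eqEcard; apply/andP; split.
    by apply/subsetP => _ /imsetP[i _ ->].
  by rewrite card_imset ?cardsT ?card_ord ?ce //; apply/injectiveP.
by rewrite ix eH eqxx.
Qed.

Lemma sum_card_states :
  \sum_(c : {ffun 'I_n -> 'I_m.+1}) #|states H c| =
  #|H| * m.+1`! * ((\prod_(s < m.+1) slot_weight s) * m.+1 ^ (n - m.+1)).
Proof.
rewrite -card_edge_orderings -sum_nat_const.
set X := [set x | _].
transitivity (\sum_(c : {ffun 'I_n -> 'I_m.+1})
  #|[set x in X | [forall s : 'I_m.+1, (c (x s))./2 == s./2]]|).
  by apply: eq_bigr => c _; apply: eq_card => x; rewrite !inE andbA.
rewrite sum_exchange_card; apply: eq_bigr => x.
rewrite inE => /andP[/injectiveP ix _].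
exact: (card_ffun_constrained
  (fun s : 'I_m.+1 => [pred i : 'I_m.+1 | i./2 == s./2]) ix).
Qed.

Lemma sum_card_partial_states (s : 'I_m.+1) :
  \sum_(c : {ffun 'I_n -> 'I_m.+1}) #|partial_states c s| =
  'C(n, m) * m`! * ((\prod_(i < m) slot_weight (lift s i)) * m.+1 ^ (n - m)).
Proof.
have := card_inj_ffuns 'I_m 'I_n; rewrite !card_ord bin_ffact => <-.
rewrite -sum_nat_const.
set X := [set x | _].
transitivity (\sum_(c : {ffun 'I_n -> 'I_m.+1})
  #|[set x in X | [forall i : 'I_m, (c (x i))./2 == (lift s i)./2]]|).
  by apply: eq_bigr => c _; apply: eq_card => x; rewrite !inE.
rewrite sum_exchange_card; apply: eq_bigr => x; rewrite inE => /injectiveP ix.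
exact: (card_ffun_constrained
  (fun i : 'I_m => [pred a : 'I_m.+1 | a./2 == (lift s i)./2]) ix).
Qed.

Import GRing.Theory Num.Theory Order.TTheory.
Local Open Scope ring_scope.

Lemma card_le_sum_slot_weight k :
  ~~ contains_copy (tight_path k.+1 m.+1) H ->
  (#|H|%:R : rat) <= 'C(n, m)%:R * \sum_(t < k) (slot_weight (slot m t))%:R^-1.
Proof.
(* With fewer than [m.+1] vertices there are no edges; this case is separate because [n - m.+1] is
   truncated. *)
move=> nH; have [ltnm|lemn] := ltnP n m.+1.
  have -> : #|H| = 0%N.
    apply/eqP; rewrite cards_eq0 -subset0; apply/subsetP => e eH.
    have /eqP ce : #|e| == m.+1 by move/forallP/(_ e): H_uniform; rewrite eH.
    by have := max_card (mem e); rewrite card_ord ce leqNgt ltnm.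
  by rewrite mulr_ge0 ?sumr_ge0 // => t _; rewrite invr_ge0.
pose W := (\prod_(s < m.+1) slot_weight s)%N.
have wpos (s : 'I_m.+1) : (0 < slot_weight s)%N by rewrite slot_weightE.
have Wpos : (0 < W)%N by rewrite prodn_gt0.
(* [K] counts the pairs of a colouring and an admissible ordering for one fixed edge. *)
pose K := (m.+1`! * W * m.+1 ^ (n - m.+1))%N.
have Kpos : 0 < K%:R :> rat by rewrite ltr0n !muln_gt0 fact_gt0 Wpos expn_gt0.
(* Dropping slot [s] divides [W] by its weight; the vertex set free adds a factor [m.+1], which
   turns m! into (m+1)!. *)
have partialE (s : 'I_m.+1) :
    ((\sum_(c : {ffun 'I_n -> 'I_m.+1}) #|partial_states c s|)%N%:R : rat) =
    'C(n, m)%:R * (slot_weight s)%:R^-1 * K%:R.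
  have w0 : (slot_weight s)%:R != 0 :> rat by rewrite pnatr_eq0 -lt0n.
  apply: (mulfI w0); rewrite mulrCA !mulrA mulfVK // mulrC -!natrM.
  congr (_ %:R).
  rewrite sum_card_partial_states /K /W (bigD1_ord s) //=.
  by rewrite -(subnSK lemn) expnS factS; lia.
rewrite -(ler_pM2r Kpos) -natrM mulr_sumr mulr_suml.
under eq_bigr => t _ do rewrite -partialE.
rewrite -natr_sum ler_nat exchange_big /=.
have -> : (#|H| * K = \sum_(c : {ffun 'I_n -> 'I_m.+1}) #|states H c|)%N.
  by rewrite sum_card_states /K /W !mulnA.
by apply: leq_sum => c _; apply: card_states_le.
Qed.

End Averaging.

(** * Evaluating the sum of inverse weights *)

Import GRing.Theory Num.Theory Order.TTheory.
Local Open Scope ring_scope.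

(** Every time contributes 1/2, and each visit to a lone slot another 1/2; such visits occur when
    [m.+1] divides [t.+1]. *)
Lemma sum_slot_weight_inv (m k : nat) :
  \sum_(t < k) ((slot_weight (slot m t))%:R^-1 : rat) =
  2^-1 * (k%:R + (if odd m then 0 else (k %/ m.+1)%:R)).
Proof.
elim: k => [|k IHk]; first by rewrite big_ord0 div0n if_same addr0 mulr0.
rewrite big_ord_recr /= IHk slot_weightE slotE divnS //.
have -> : (m.+1 %| k.+1)%N = (k %% m.+1 == m)%N.
  rewrite /dvdn -addn1 -modnDml addn1.
  have := ltn_pmod k (ltn0Sn m); rewrite ltnS leq_eqVlt => /orP[/eqP ->|lt].
    by rewrite modnn !eqxx.
  by rewrite modn_small // (ltn_eqF lt).
case: (odd m) => /=; first by rewrite !addr0 -[k.+1%:R]natr1 mulrDr mulr1.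
rewrite natrD -[k.+1%:R]natr1.
by case: eqP => _ /=; rewrite ?invr1; field.
Qed.

Theorem theorem1p2 (n r k : nat) (hn : (1 <= n)%N) (hr : (2 <= r)%N)
    (hk : (1 <= k)%N) :
  ((turan_ex n r (tight_path k r))%:R : rat) <=
    if ~~ odd r then (k%:R - 1) / 2%:R * 'C(n, r - 1)%:R
    else 1 / 2%:R * (k%:R + ((k - 1) %/ r)%:R) * 'C(n, r - 1)%:R.
Proof.
case: r hr => // m _; case: k hk => // k _.
rewrite /turan_ex !subSS !subn0 /=.
elim/big_ind: _ => [|a b ha hb|G /andP[Gu nG]].
- by case: ifP => _; rewrite -[k.+1%:R]natr1 ?addrK !mulr_ge0 ?addr_ge0.
- by rewrite /maxn; case: ifP.
apply: le_trans (card_le_sum_slot_weight Gu nG) _.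
rewrite sum_slot_weight_inv mulrC -[k.+1%:R]natr1; case: (odd m) => /=.
  by rewrite addr0 addrK [_ / _]mulrC.
(* For odd uniformity the averaging bound is stronger than the claim: it has the path length minus
   one in place of the path length. *)
by rewrite ler_wpM2r // mul1r ler_wpM2l // lerD2r lerDl.
Qed.
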